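(* Let $X$ be a topological space and $A$ a subspace of $X$. If $A$ is totally path disconnected and meets each path component of $X$, then the natural morphism $$\pi_1(X,A)^{\mathrm{totab}}\to H_1(X,A)$$ is an isomorphism.
   Context: $\pi_1(X,A)$ denotes the fundamental groupoid of $X$ on the set $A$ of base points: its objects are the points of $A$ and its morphisms are homotopy classes rel end points of paths in $X$ with both end points in $A$. For a groupoid $G$, the universal abelianisation $G\to G^{\mathrm{totab}}$ is the universal morphism from $G$ to an abelian group (regarded as a groupoid with one object). $H_1(X,A)$ is the usual first relative singular homology group, computed here with (normalised) cubical singular chains: $C_n(X)$ is the free abelian group on the singular cubes $I^n\to X$ modulo the subgroup generated by degenerate cubes, with boundary $\partial k=\sum_{i=1}^n(-1)^i(\partial_i^-k-\partial_i^+k)$, and $H_*(X,A)$ is the homology of $C_*(X)/C_*(A)$. The natural morphism is the one induced by sending the class of a path $f$ with end points in $A$ to the relative homology class of the singular $1$-cube $f$. $A$ is totally path disconnected if every path in $A$ is constant. *)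

(* Defs.v *)
From HB Require Import structures.
From mathcomp Require Import all_boot all_order all_algebra.
From mathcomp Require Import all_classical reals topology normedtype homotopy.
From mathcomp Require Import freeg lra.

Set Implicit Arguments.
Unset Strict Implicit.
Unset Printing Implicit Defensive.
Import Order.TTheory GRing.Theory Num.Theory.
Import numFieldNormedType.Exports.
Local Open Scope classical_set_scope.
Local Open Scope ring_scope.
Local Open Scope quotient_scope.

Definition subgroup (V : zmodType) (P : set V) :=
  P 0 /\ forall u v, P u -> P v -> P (u - v).

Definition generated (V : zmodType) (S : set V) : set V :=
  smallest (@subgroup V) S.

Section generated_theory.
Variables (V : zmodType) (S : set V).

Lemma generated_subgroup : subgroup (generated S).
Proof.
split=> [P [[]]//|u v Su Sv P PS].
by case: (PS) => -[_ PB] _; apply: PB; [exact: Su|exact: Sv].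
Qed.

Lemma sub_generated : S `<=` generated S. Proof. exact: sub_smallest. Qed.

Lemma generated0 : generated S 0. Proof. by case: generated_subgroup. Qed.

Lemma generatedB u v : generated S u -> generated S v -> generated S (u - v).
Proof. by case: generated_subgroup => _; apply. Qed.

Lemma generatedN u : generated S u -> generated S (- u).
Proof. by move=> Su; rewrite -sub0r; apply: generatedB => //; exact: generated0. Qed.

Lemma generatedD u v : generated S u -> generated S v -> generated S (u + v).
Proof.
by move=> Su Sv; rewrite -[v]opprK; apply: generatedB => //; exact: generatedN.
Qed.

End generated_theory.

(** [zquot S] is the quotient of an abelian group by the subgroup generated by S. *)
Section quotient.
Variables (V : zmodType) (S : set V).

Definition quot_rel (u v : V) : bool := `[< generated S (u - v) >].

Lemma quot_rel_refl : reflexive quot_rel.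
Proof. by move=> u; apply/asboolP; rewrite subrr; exact: generated0. Qed.

Lemma quot_rel_sym : symmetric quot_rel.
Proof.
by move=> u v; apply/asboolP/asboolP => /generatedN; rewrite opprB.
Qed.

Lemma quot_rel_trans : transitive quot_rel.
Proof.
move=> v u w /asboolP uv /asboolP vw; apply/asboolP.
by rewrite -(subrKA v); exact: generatedD.
Qed.

Canonical quot_equiv :=
  EquivRel quot_rel quot_rel_refl quot_rel_sym quot_rel_trans.

Definition zquot := {eq_quot quot_rel}.

HB.instance Definition _ := Choice.on zquot.
HB.instance Definition _ := EqQuotient.on zquot.

Definition zquot_zero : zquot := lift_cst zquot 0.
Definition zquot_opp := lift_op1 zquot -%R.
Definition zquot_add := lift_op2 zquot +%R.

Canonical zquot_zero_morph := PiConst zquot_zero.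

Lemma pi_zquot_opp : {morph \pi : x / - x >-> zquot_opp x}.
Proof.
move=> x; unlock zquot_opp; apply/eqmodP/asboolP => /=.
rewrite -opprD; apply: generatedN.
by have /eqmodP/asboolP := esym (reprK (\pi_zquot x)).
Qed.
Canonical zquot_opp_morph := PiMorph1 pi_zquot_opp.

Lemma pi_zquot_add : {morph \pi : x y / x + y >-> zquot_add x y}.
Proof.
move=> x y; unlock zquot_add; apply/eqmodP/asboolP => /=.
rewrite opprD addrACA; apply: generatedD.
  by have /eqmodP/asboolP := esym (reprK (\pi_zquot x)).
by have /eqmodP/asboolP := esym (reprK (\pi_zquot y)).
Qed.
Canonical zquot_add_morph := PiMorph2 pi_zquot_add.

Lemma zquot_addA : associative zquot_add.
Proof. by move=> x y z; rewrite -[x]reprK -[y]reprK -[z]reprK !piE addrA. Qed.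
Lemma zquot_addC : commutative zquot_add.
Proof. by move=> x y; rewrite -[x]reprK -[y]reprK !piE addrC. Qed.
Lemma zquot_add0 : left_id zquot_zero zquot_add.
Proof. by move=> x; rewrite -[x]reprK !piE add0r. Qed.
Lemma zquot_addN : left_inverse zquot_zero zquot_opp zquot_add.
Proof. by move=> x; rewrite -[x]reprK !piE addNr. Qed.

HB.instance Definition _ := GRing.isZmodule.Build zquot
  zquot_addA zquot_addC zquot_add0 zquot_addN.

Definition zproj (v : V) : zquot := \pi v.

Lemma zproj_is_zmod_morphism : zmod_morphism zproj.
Proof. by move=> u v; rewrite /zproj -[RHS]/(zquot_add _ (zquot_opp _)) !piE. Qed.
HB.instance Definition _ :=
  GRing.isZmodMorphism.Build V zquot zproj zproj_is_zmod_morphism.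

Lemma zprojP u v : zproj u = zproj v <-> generated S (u - v).
Proof.
by split=> [/eqmodP/asboolP|uv]; last by apply/eqmodP/asboolP.
Qed.

Lemma zproj_eq0 u : zproj u = 0 <-> generated S u.
Proof. by rewrite -(raddf0 zproj) zprojP subr0. Qed.

Lemma zproj_gen u : S u -> zproj u = 0.
Proof. by move=> Su; apply/zproj_eq0; exact: sub_generated. Qed.

Lemma zproj_surj (x : zquot) : exists v, zproj v = x.
Proof. by exists (repr x); exact: reprK. Qed.

End quotient.

Section quotient_lift.
Variables (V W : zmodType) (S : set V) (f : {additive V -> W}).
Hypothesis f0 : forall v, S v -> f v = 0.

Lemma generated_ker v : generated S v -> f v = 0.
Proof.
apply: (@smallest_sub _ _ _ [set v | f v = 0]) => //; split=> /=.
  exact: raddf0.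
by move=> u w /= fu fw; rewrite raddfB fu fw subr0.
Qed.

Definition zquot_lift (x : zquot S) : W := let _ := f0 in f (repr x).

Lemma zquot_liftE v : zquot_lift (zproj S v) = f v.
Proof.
apply/eqP; rewrite -subr_eq0 -raddfB; apply/eqP/generated_ker/zprojP.
exact: reprK.
Qed.

Lemma zquot_lift_is_zmod_morphism : zmod_morphism zquot_lift.
Proof.
move=> x y; have [u <-] := zproj_surj x; have [v <-] := zproj_surj y.
by rewrite -raddfB !zquot_liftE raddfB.
Qed.
HB.instance Definition _ := GRing.isZmodMorphism.Build (zquot S) W zquot_lift
  zquot_lift_is_zmod_morphism.

End quotient_lift.

Section kernel.
Variables (V W : zmodType) (g : {additive V -> W}).

Definition zker_pred : {pred V} := [pred v | g v == 0].

Lemma zker_pred_closed : zmod_closed zker_pred.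
Proof.
split=> [|u v]; rewrite !inE ?raddf0// => /eqP gu /eqP gv.
by rewrite raddfB gu gv subr0.
Qed.
HB.instance Definition _ := GRing.isZmodClosed.Build V zker_pred zker_pred_closed.

Definition zker := {v : V | zker_pred v}.
HB.instance Definition _ := SubChoice.on zker.
HB.instance Definition _ := [SubChoice_isSubZmodule of zker by <:].

Definition to_zker (v : V) (gv : g v = 0) : zker := exist _ v (introT eqP gv).

End kernel.

(** Ker g / (Im f /\ Ker g), which is Ker g / Im f for a complex U -f-> V -g-> W. *)
Definition homology (U V W : zmodType) (f : {additive U -> V})
    (g : {additive V -> W}) : zmodType :=
  zquot ([set z : zker g | exists u, f u = val z]%classic).

Section free.
Variables (K : choiceType).

Definition free_lift (M : zmodType) (f : K -> M) : {freeg K / int} -> M :=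
  fglift (f : K -> zmodule M).

Lemma free_lift_is_zmod_morphism (M : zmodType) (f : K -> M) :
  zmod_morphism (free_lift f).
Proof. exact: (@lift_is_additive int K (zmodule M) f). Qed.
HB.instance Definition _ (M : zmodType) (f : K -> M) :=
  GRing.isZmodMorphism.Build {freeg K / int} M (free_lift f)
    (free_lift_is_zmod_morphism f).

Lemma free_liftU (M : zmodType) (f : K -> M) k : free_lift f << k >> = f k.
Proof. by rewrite /free_lift liftU scale1r. Qed.

Lemma free_ext (M : zmodType) (f g : {additive {freeg K / int} -> M}) :
  (forall k, f << k >> = g << k >>) -> f =1 g.
Proof.
move=> fg D; rewrite -(freeg_sumE D) !raddf_sum; apply: eq_bigr => k _.
have -> : << coeff k D *g k >> = << k >> *~ coeff k D :> {freeg K / int}.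
  by rewrite freegU_mulz intz.
by rewrite !raddfMz fg.
Qed.

End free.

Lemma ptws_continuous (T U : topologicalType) (n : nat)
    (f : T -> {ptws 'I_n -> U}) :
  (forall i, continuous (fun t => f t i)) -> continuous f.
Proof.
move=> cf t; apply/cvg_sup => i.
exact: (@continuous_comp_initial _ T U (fun g : {ptws 'I_n -> U} => g i) f (cf i) t).
Qed.

Lemma ptws_proj_continuous (U : topologicalType) (n : nat) (i : 'I_n) :
  continuous (fun g : {ptws 'I_n -> U} => g i).
Proof. exact: (@proj_continuous 'I_n (fun=> U) i). Qed.

Lemma continuous_compT (T U V : topologicalType) (f : T -> U) (g : U -> V) :
  continuous f -> continuous g -> continuous (g \o f).
Proof. by move=> cf cg t; apply: continuous_comp; [exact: cf|exact: cg]. Qed.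

Lemma continuous_pair (T U V : topologicalType) (f : T -> U) (g : T -> V) :
  continuous f -> continuous g -> continuous (fun t => (f t, g t)).
Proof. by move=> cf cg t; apply: cvg_pair; [exact: cf|exact: cg]. Qed.

Lemma continuous_fst (U V : topologicalType) : continuous (@fst U V).
Proof. by move=> x; exact: cvg_fst. Qed.

Lemma continuous_snd (U V : topologicalType) : continuous (@snd U V).
Proof. by move=> x; exact: cvg_snd. Qed.

Lemma continuous_if_le (R : realType) (T X : topologicalType) (g : T -> R)
    (c : R) (f1 f2 : T -> X) :
  continuous g -> continuous f1 -> continuous f2 ->
  (forall t, g t = c -> f1 t = f2 t) ->
  continuous (fun t => if g t <= c then f1 t else f2 t).
Proof.
move=> cg c1 c2 f12 t U nU.
suff : \forall s \near t, U (if g s <= c then f1 s else f2 s) by [].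
have [gc|cgt|gc] := ltgtP (g t) c.
- have ng : \forall s \near t, g s < c by apply: (cvgr_lt (g t)) => //; exact: cg.
  have n1 : \forall s \near t, U (f1 s) by apply: c1; rewrite /= ltW in nU.
  by apply: filterS2 ng n1 => s /ltW ->.
- have ng : \forall s \near t, c < g s by apply: (cvgr_gt (g t)) => //; exact: cg.
  have n2 : \forall s \near t, U (f2 s) by apply: c2; rewrite /= leNgt cgt in nU.
  by apply: filterS2 ng n2 => s; rewrite leNgt => ->.
- rewrite /= gc lexx in nU.
  have n1 : \forall s \near t, U (f1 s) by exact: c1.
  have n2 : \forall s \near t, U (f2 s) by apply: c2; rewrite -f12.
  by apply: filterS2 n1 n2 => s; case: ifP.
Qed.

Definition unitI (R : realType) : Type := set_type (`[0, 1]%classic : set R).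

Section unit_interval.
Variable R : realType.
Implicit Types t : unitI R.

HB.instance Definition _ := Topological.on (unitI R).

Definition ival (t : unitI R) : R := set_val t.

Lemma ival_ge0 t : 0 <= ival t.
Proof. by have := set_valP t; rewrite /= in_itv/= => /andP[]. Qed.

Lemma ival_le1 t : ival t <= 1.
Proof. by have := set_valP t; rewrite /= in_itv/= => /andP[]. Qed.

Lemma ival_inj : injective ival. Proof. exact: val_inj. Qed.

Definition clampr (r : R) : R := Num.max 0 (Num.min 1 r).

Lemma clampr_in r : clampr r \in (`[0, 1]%classic : set R).
Proof.
by rewrite inE/= in_itv/= /clampr le_max lexx/= ge_max ler01 ge_min lexx.
Qed.

(* the retraction of the real line onto the unit interval *)
Definition clampI (r : R) : unitI R := SigSub (clampr_in r).

Lemma clampIE r : ival (clampI r) = clampr r. Proof. by []. Qed.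

Lemma clampI_id r : 0 <= r <= 1 -> ival (clampI r) = r.
Proof. by case/andP=> r0 r1; rewrite clampIE /clampr min_r// max_r. Qed.

Lemma ivalK t : clampI (ival t) = t.
Proof. by apply: ival_inj; rewrite clampI_id// ival_ge0 ival_le1. Qed.

Lemma clampI_le0 r : r <= 0 -> clampI r = clampI 0.
Proof.
move=> r0; apply: ival_inj; rewrite [RHS]clampI_id ?lexx ?ler01// clampIE /clampr.
by rewrite max_l// ge_min r0 orbT.
Qed.

Lemma clampI_ge1 r : 1 <= r -> clampI r = clampI 1.
Proof.
move=> r1; apply: ival_inj; rewrite [RHS]clampI_id ?lexx ?ler01// clampIE /clampr.
by rewrite min_l// max_r// ler01.
Qed.

Lemma ival_continuous : continuous ival. Proof. exact: initial_continuous. Qed.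

Lemma clampI_continuous : continuous clampI.
Proof.
apply: (@continuous_comp_initial (unitI R) R R set_val clampI) => r.
rewrite /comp /= -[X in continuous_at _ X]/clampr.
apply: (@continuous_max R R (fun=> 0) (Num.min 1)); first exact: cvg_cst.
by apply: (@continuous_min R R (fun=> 1) id); [exact: cvg_cst|exact: cvg_id].
Qed.

Lemma clampI01 : clampI 0 != clampI 1.
Proof.
apply/negP => /eqP /(congr1 ival); rewrite !clampI_id ?lexx ?ler01//.
by move/esym/eqP; rewrite oner_eq0.
Qed.

HB.instance Definition _ := isBiPointed.Build (unitI R) clampI01.

Lemma ival0 : ival zero = 0. Proof. by rewrite clampI_id// lexx ler01. Qed.
Lemma ival1 : ival one = 1. Proof. by rewrite clampI_id// lexx ler01. Qed.

End unit_interval.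

Section cubes.
Variables (R : realType) (X : topologicalType).

Definition icube (n : nat) : topologicalType := {ptws 'I_n -> unitI R}.

Definition scube (n : nat) := continuousType (icube n) X.

(* [insert i a t] is (t_0, ..., t_{i-1}, a, t_i, ..., t_{n-1}) *)
Definition insert n (i : 'I_n.+1) (a : unitI R) (t : icube n) : icube n.+1 :=
  fun j => if unlift i j is Some j' then t j' else a.

Lemma insert_continuous n (i : 'I_n.+1) a : continuous (@insert n i a).
Proof.
apply: ptws_continuous => j; rewrite /insert.
by case: unliftP => [j' _|_]; [exact: ptws_proj_continuous|exact: cst_continuous].
Qed.

Lemma face_continuous n (i : 'I_n.+1) a (k : scube n.+1) :
  continuous (k \o @insert n i a).
Proof. by apply: continuous_compT; [exact: insert_continuous|exact: cts_fun]. Qed.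

(* [face i zero k] and [face i one k] are the faces usually written
   $\partial_{i+1}^- k$ and $\partial_{i+1}^+ k$. *)
Definition face n (i : 'I_n.+1) (a : unitI R) (k : scube n.+1) : scube n :=
  mkcts (face_continuous (i := i) (a := a) (k := k)).

Definition degenerate (n : nat) : scube n -> Prop :=
  match n with
  | 0 => fun=> False
  | m.+1 => fun k => exists (i : 'I_m.+1) (k' : scube m),
      forall t : icube m.+1, k t = k' (fun j => t (fintype.lift i j))
  end.

Lemma independent_degenerate n (k : scube n) (i : 'I_n) :
  (forall s t : icube n, (forall j, j != i -> s j = t j) -> k s = k t) ->
  degenerate k.
Proof.
case: n k i => [k []//|n k i ki]; exists i, (face i zero k) => t.
apply: ki => j ji; rewrite /insert; case: unliftP ji => [j' ->//|->].
by rewrite eqxx.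
Qed.

Lemma face_degenerate n (i i0 : 'I_n.+1) a (k : scube n.+1) (k' : scube n) :
  (forall t, k t = k' (fun j => t (fintype.lift i0 j))) -> i != i0 ->
  degenerate (face i a k).
Proof.
move=> kk'; case: (unliftP i i0) => [i' i0E _|->]; last by rewrite eqxx.
apply: (@independent_degenerate _ _ i') => s t st /=.
rewrite /mkcts /= !kk'; congr (k' _); apply/funext => j; rewrite /insert.
case: unliftP => // j' jE; apply: st; apply: contra_eq_neq jE => ->.
by rewrite -i0E eq_sym neq_lift.
Qed.

(* The index i starts at 0, hence the sign (-1)^(i+1). *)
Definition free_boundary n : {freeg (scube n.+1) / int} -> {freeg (scube n) / int} :=
  free_lift (fun k : scube n.+1 =>
    \sum_(i < n.+1) (-1) ^+ i.+1 *: (<< face i zero k >> - << face i one k >>)).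
HB.instance Definition _ n := GRing.Additive.on (@free_boundary n).

Definition degenerate_chains n : set {freeg (scube n) / int} :=
  [set << k >> | k in @degenerate n].

Definition chains n : zmodType := zquot (@degenerate_chains n).

Lemma boundary_degenerate n c :
  @degenerate_chains n.+1 c ->
  (zproj (@degenerate_chains n) \o @free_boundary n) c = 0.
Proof.
move=> [k [i0 [k' kk']] <-] /=; rewrite /free_boundary free_liftU.
rewrite raddf_sum big1// => i _.
have [->|ii0] := eqVneq i i0.
  suff -> : face i0 zero k = face i0 one k by rewrite subrr scaler0 raddf0.
  apply/continuousEP => t; rewrite /= /mkcts /= !kk'; congr (k' _).
  by apply/funext => j; rewrite /insert liftK.
have faceD a : zproj (@degenerate_chains n) << face i a k >> = 0.
  by apply: zproj_gen; exists (face i a k) => //; exact: face_degenerate kk' ii0.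
by rewrite -signr_odd scaler_sign; case: odd; rewrite ?raddfN/= raddfB/= !faceD subrr ?oppr0.
Qed.


Definition boundary n : chains n.+1 -> chains n := zquot_lift (@boundary_degenerate n).
HB.instance Definition _ n := GRing.Additive.on (@boundary n).

Definition cube_chain n (k : scube n) : chains n := zproj (@degenerate_chains n) << k >>.

Variable A : set X.

(* A singular cube of the subspace A is a singular cube of X with image in A:
   these are the generators of $C_n(A)$, seen inside $C_n(X)$. *)
Definition subspace_chains n : set (chains n) :=
  [set cube_chain k | k in [set k : scube n | forall t, A (k t)]].

Definition rel_chains n : zmodType := zquot (@subspace_chains n).

Lemma boundaryE n (k : scube n.+1) :
  boundary (cube_chain k) = \sum_(i < n.+1)
    (cube_chain (face i zero k) - cube_chain (face i one k)) *~ (-1) ^+ i.+1.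
Proof.
rewrite /boundary /cube_chain zquot_liftE /= /free_boundary free_liftU raddf_sum.
apply: eq_bigr => i _; rewrite -signr_odd scaler_sign.
by case: odd; rewrite ?raddfN/= raddfB // expr1 mulrN1z.
Qed.

Lemma boundary_subspace n c :
  @subspace_chains n.+1 c -> (zproj (@subspace_chains n) \o @boundary n) c = 0.
Proof.
move=> [k Ak <-] /=; rewrite boundaryE raddf_sum big1// => i _.
have faceA a : zproj (@subspace_chains n) (cube_chain (face i a k)) = 0.
  by apply: zproj_gen; exists (face i a k) => // t; exact: Ak.
by rewrite raddfMz raddfB /= !faceA subrr mul0rz.
Qed.

Definition rel_boundary n : rel_chains n.+1 -> rel_chains n :=
  zquot_lift (@boundary_subspace n).
HB.instance Definition _ n := GRing.Additive.on (@rel_boundary n).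

Definition rel_chain n (c : chains n) : rel_chains n := zproj (@subspace_chains n) c.

Lemma rel_boundaryE n (c : chains n.+1) :
  rel_boundary (rel_chain c) = rel_chain (boundary c).
Proof. exact: zquot_liftE. Qed.

Definition H1 : zmodType := homology (@rel_boundary 1) (@rel_boundary 0).

End cubes.

Record groupoid := Groupoid {
  gob :> Type;
  ghom : gob -> gob -> Type;
  gid : forall a, ghom a a;
  gcomp : forall a b c, ghom a b -> ghom b c -> ghom a c;
  ginv : forall a b, ghom a b -> ghom b a;
  gcompA : forall a b c d (f : ghom a b) (g : ghom b c) (h : ghom c d),
    gcomp f (gcomp g h) = gcomp (gcomp f g) h;
  gcomp1f : forall a b (f : ghom a b), gcomp (gid a) f = f;
  gcompf1 : forall a b (f : ghom a b), gcomp f (gid b) = f;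
  gcompfV : forall a b (f : ghom a b), gcomp f (ginv f) = gid a;
  gcompVf : forall a b (f : ghom a b), gcomp (ginv f) f = gid b
}.

Record groupoid_morphism (G H : groupoid) := GroupoidMorphism {
  gmor_ob : G -> H;
  gmor :> forall a b : G, ghom a b -> ghom (gmor_ob a) (gmor_ob b);
  gmor_id : forall a, gmor (gid a) = gid (gmor_ob a);
  gmor_comp : forall a b c (f : ghom a b) (g : ghom b c),
    gmor (gcomp f g) = gcomp (gmor f) (gmor g)
}.

(* an abelian group as a groupoid with one object *)
Definition groupoid_of_zmod (B : zmodType) : groupoid :=
  @Groupoid unit (fun _ _ => B) (fun=> 0) (fun _ _ _ => +%R) (fun _ _ => -%R)
    (fun _ _ _ _ => @addrA B) (fun _ _ => @add0r B) (fun _ _ => @addr0 B)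
    (fun _ _ => @subrr B) (fun _ _ => @addNr B).

Definition gval (G : groupoid) (B : zmodType)
  (u : groupoid_morphism G (groupoid_of_zmod B)) (a b : G) (f : ghom a b) : B :=
  u a b f.

Definition universal_abelianisation (G : groupoid) (T : zmodType)
    (u : groupoid_morphism G (groupoid_of_zmod T)) :=
  forall (B : zmodType) (v : groupoid_morphism G (groupoid_of_zmod B)),
  exists phi : {additive T -> B},
    (forall (a b : G) (f : ghom a b), phi (gval u f) = gval v f) /\
    (forall psi : {additive T -> B},
      (forall (a b : G) (f : ghom a b), psi (gval u f) = gval v f) -> psi =1 phi).

Section totab.
Variable G : groupoid.

Definition arrow : choiceType := {classic {ab : G * G & ghom ab.1 ab.2}}.

Definition to_arrow (a b : G) (f : ghom a b) : arrow :=
  existT (fun ab : G * G => ghom ab.1 ab.2) (a, b) f.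

(* [totab G] is the free abelian group on the arrows of G modulo these relations;
   [totab_universal] below shows that [totab_unit] is the universal morphism from
   G to an abelian group. *)
Definition totab_relations : set {freeg arrow / int} :=
  [set r | exists (a b c : G) (f : ghom a b) (g : ghom b c),
    r = << to_arrow (gcomp f g) >> - (<< to_arrow f >> + << to_arrow g >>)].

Definition totab : zmodType := zquot totab_relations.

Definition totab_arrow (a b : G) (f : ghom a b) : totab :=
  zproj totab_relations << to_arrow f >>.

Lemma totab_comp (a b c : G) (f : ghom a b) (g : ghom b c) :
  totab_arrow (gcomp f g) = totab_arrow f + totab_arrow g.
Proof.
rewrite /totab_arrow -raddfD; apply/zprojP; apply: sub_generated => /=.
by exists a, b, c, f, g.
Qed.

Lemma totab_id (a : G) : totab_arrow (gid a) = 0.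
Proof.
apply: (addIr (totab_arrow (gid a))).
by rewrite add0r -totab_comp gcomp1f.
Qed.

Definition totab_unit : groupoid_morphism G (groupoid_of_zmod totab) :=
  @GroupoidMorphism G (groupoid_of_zmod totab) (fun=> tt) totab_arrow
    totab_id totab_comp.

Section lift.
Variables (B : zmodType) (v : groupoid_morphism G (groupoid_of_zmod B)).

Definition totab_free_lift : {freeg arrow / int} -> B :=
  free_lift (fun f : arrow => gval v (projT2 f)).
HB.instance Definition _ := GRing.Additive.on totab_free_lift.

Lemma totab_free_lift_rel r : totab_relations r -> totab_free_lift r = 0.
Proof.
move=> [a [b [c [f [g ->]]]]]; apply/eqP; rewrite raddfB subr_eq0 raddfD.
by rewrite /= /totab_free_lift !free_liftU /= /gval gmor_comp.
Qed.

Definition totab_lift : totab -> B := zquot_lift totab_free_lift_rel.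
HB.instance Definition _ := GRing.Additive.on totab_lift.

Lemma totab_liftE (a b : G) (f : ghom a b) :
  totab_lift (gval totab_unit f) = gval v f.
Proof.
rewrite /gval /= /totab_lift /totab_arrow zquot_liftE /=.
by rewrite /totab_free_lift free_liftU.
Qed.

End lift.

Lemma totab_universal : universal_abelianisation totab_unit.
Proof.
move=> B v; exists (totab_lift v); split=> [a b f|psi psiv x].
  exact: totab_liftE.
have [D <-] := zproj_surj x.
apply: (@free_ext _ _ (psi \o zproj _) (totab_lift v \o zproj _)).
refine (fun k : {ab : G * G & ghom ab.1 ab.2} => _); case: k => -[a b] f.
by rewrite /= (psiv a b f) (totab_liftE v f).
Qed.

End totab.

Section paths.
Variables (R : realType) (X : topologicalType).
Local Notation I := (unitI R).
Implicit Types x y z : X.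

Definition ipath x y := {path I from x to y in X}.

(* homotopy rel end points *)
Definition homotopic x y (f g : ipath x y) := exists h : I * I -> X,
  [/\ continuous h,
      forall t, h (t, zero) = f t, forall t, h (t, one) = g t,
      forall s, h (zero, s) = x & forall s, h (one, s) = y].

(* the homotopy F followed by the homotopy G, at time v *)
Definition paste (T : topologicalType) (v : T -> I) (F G : T * I -> X) : T -> X :=
  fun t => if ival (v t) <= 2^-1 then F (t, clampI (2 * ival (v t)))
           else G (t, clampI (2 * ival (v t) - 1)).

Lemma paste_continuous (T : topologicalType) (v : T -> I) (F G : T * I -> X) :
  continuous v -> continuous F -> continuous G ->
  (forall t, F (t, one) = G (t, zero)) -> continuous (paste v F G).
Proof.
move=> cv cF cG FG.
have c2 : continuous (fun t => 2 * ival (v t) : R).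
  move=> t; apply: cvgM; first exact: cvg_cst.
  exact: (continuous_compT cv (@ival_continuous R)).
have id_c : continuous (@id T) by move=> t; exact: cvg_id.
apply: (@continuous_if_le R T X (fun t => ival (v t)) (2^-1)
  (fun t => F (t, clampI (2 * ival (v t))))
  (fun t => G (t, clampI (2 * ival (v t) - 1)))).
- exact: (continuous_compT cv (@ival_continuous R)).
- apply: (@continuous_compT _ _ _ (fun t => (t, clampI (2 * ival (v t)))) F) => //.
  apply: continuous_pair => //.
  exact: (continuous_compT c2 (@clampI_continuous R)).
- apply: (@continuous_compT _ _ _ (fun t => (t, clampI (2 * ival (v t) - 1))) G) => //.
  apply: continuous_pair => //.
  apply: (@continuous_compT _ _ _ (fun t => 2 * ival (v t) - 1) (@clampI R)).
    by move=> t; apply: cvgB; [exact: c2|exact: cvg_cst].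
  exact: clampI_continuous.
- move=> t ->; rewrite mulfV ?pnatr_eq0// subrr.
  exact: FG.
Qed.

Lemma paste_half (T : topologicalType) (v : T -> I) (F G : T * I -> X) t :
  F (t, one) = G (t, zero) -> 2^-1 <= ival (v t) ->
  paste v F G t = G (t, clampI (2 * ival (v t) - 1)).
Proof.
rewrite /paste => FG; case: ltgtP => // <- _.
by rewrite mulfV ?pnatr_eq0// subrr.
Qed.

Definition path_id x : ipath x x :=
  mk_path (@cst_continuous I X x) (erefl x) (erefl x).

Definition reverse (t : I) : I := clampI (1 - ival t).

Lemma reverse0 : reverse zero = one.
Proof. by rewrite /reverse ival0 subr0. Qed.
Lemma reverse1 : reverse one = zero.
Proof. by rewrite /reverse ival1 subrr. Qed.

Lemma reverse_continuous : continuous reverse.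
Proof.
apply: (@continuous_compT I R I (fun t => 1 - ival t) (@clampI R)).
  by move=> t; apply: (@continuousB R R _ (fun=> 1) (@ival R));
    [exact: cst_continuous|exact: ival_continuous].
exact: clampI_continuous.
Qed.

Section reverse_path.
Variables (x y : X) (f : ipath x y).

Lemma path_inv_continuous : continuous (f \o reverse).
Proof. by apply: continuous_compT; [exact: reverse_continuous|exact: cts_fun]. Qed.
Lemma path_inv0 : (f \o reverse) zero = y.
Proof. by rewrite /= reverse0 path_one. Qed.
Lemma path_inv1 : (f \o reverse) one = x.
Proof. by rewrite /= reverse1 path_zero. Qed.

Definition path_inv : ipath y x :=
  mk_path path_inv_continuous path_inv0 path_inv1.
End reverse_path.

Section concatenation.
Variables (x y z : X) (f : ipath x y) (g : ipath y z).

Definition concat (t : I) : X :=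
  if ival t <= 2^-1 then f (clampI (2 * ival t)) else g (clampI (2 * ival t - 1)).

Lemma concat_continuous : continuous concat.
Proof.
apply: (@paste_continuous I id (f \o snd) (g \o snd)).
- by move=> t; exact: cvg_id.
- by apply: continuous_compT; [exact: continuous_snd|exact: cts_fun].
- by apply: continuous_compT; [exact: continuous_snd|exact: cts_fun].
- by move=> t /=; rewrite path_zero path_one.
Qed.

Lemma concat0 : concat zero = x.
Proof. by rewrite /concat ival0 invr_ge0 ler0n mulr0 path_zero. Qed.

Lemma concat1 : concat one = z.
Proof.
rewrite /concat ival1; case: ifP => [|_]; first by move=> ?; exfalso; lra.
by rewrite (_ : 2 * 1 - 1 = 1) ?path_one//; lra.
Qed.

Definition path_comp : ipath x z := mk_path concat_continuous concat0 concat1.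

Lemma concat_first t : ival t <= 2^-1 -> path_comp t = f (clampI (2 * ival t)).
Proof. by move=> t2; rewrite /path_comp /= /mk_path /concat t2. Qed.

Lemma concat_second t : 2^-1 <= ival t -> path_comp t = g (clampI (2 * ival t - 1)).
Proof.
move=> t2; rewrite /path_comp /= /mk_path /concat.
case: ltgtP t2 => // <- _.
by rewrite mulfV ?pnatr_eq0// subrr path_zero path_one.
Qed.
End concatenation.

Lemma homotopic_refl x y (f : ipath x y) : homotopic f f.
Proof.
exists (f \o fst); split=> //= *; rewrite ?path_zero ?path_one//.
by apply: continuous_compT; [exact: continuous_fst|exact: cts_fun].
Qed.

Lemma homotopic_sym x y (f g : ipath x y) : homotopic f g -> homotopic g f.
Proof.
move=> [h [ch h0 h1 hx hy]]; exists (fun ts => h (ts.1, reverse ts.2)); split=> /=.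
- apply: (@continuous_compT _ _ _ (fun ts => (ts.1, reverse ts.2)) h) => //.
  apply: continuous_pair; first exact: continuous_fst.
  by apply: (continuous_compT _ reverse_continuous); exact: continuous_snd.
- by move=> t; rewrite reverse0.
- by move=> t; rewrite reverse1.
- by move=> s; exact: hx.
- by move=> s; exact: hy.
Qed.

Lemma homotopic_trans x y (f g k : ipath x y) :
  homotopic f g -> homotopic g k -> homotopic f k.
Proof.
move=> [h [ch h0 h1 hx hy]] [h' [ch' h0' h1' hx' hy']].
pose F (u : (I * I) * I) := h (u.1.1, u.2).
pose F' (u : (I * I) * I) := h' (u.1.1, u.2).
have cp : continuous (fun u : (I * I) * I => (u.1.1, u.2)).
  apply: continuous_pair; last exact: continuous_snd.
  by apply: (@continuous_compT _ _ _ fst fst); exact: continuous_fst.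
have FF' t : F (t, one) = F' (t, zero) by rewrite /F /F' /= h1 h0'.
exists (paste snd F F'); split=> /=.
- apply: paste_continuous => //; first exact: continuous_snd.
    exact: (continuous_compT cp ch).
  exact: (continuous_compT cp ch').
- by move=> t; rewrite /paste /= ival0 invr_ge0 ler0n mulr0 /F /= h0.
- move=> t; rewrite paste_half//= ival1; last lra.
  by rewrite (_ : 2 * 1 - 1 = 1) ?h1'// /F' /= ?h1'//; lra.
- by move=> s; rewrite /paste /F /F' /= hx hx' if_same.
- by move=> s; rewrite /paste /F /F' /= hy hy' if_same.
Qed.

Lemma homotopic_comp x y z (f f' : ipath x y) (g g' : ipath y z) :
  homotopic f f' -> homotopic g g' -> homotopic (path_comp f g) (path_comp f' g').
Proof.
move=> [h [ch h0 h1 hx hy]] [k [ck k0 k1 ky kz]].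
pose F (u : (I * I) * I) := h (u.2, u.1.2).
pose F' (u : (I * I) * I) := k (u.2, u.1.2).
have cp : continuous (fun u : (I * I) * I => (u.2, u.1.2)).
  apply: continuous_pair; first exact: continuous_snd.
  by apply: (@continuous_compT _ _ _ fst snd);
    [exact: continuous_fst|exact: continuous_snd].
have FF' t : F (t, one) = F' (t, zero) by rewrite /F /F' /= hy ky.
exists (paste fst F F'); split=> /=.
- apply: paste_continuous => //; first exact: continuous_fst.
    exact: (continuous_compT cp ch).
  exact: (continuous_compT cp ck).
- by move=> t; rewrite /paste /F /F' /= h0 k0.
- by move=> t; rewrite /paste /F /F' /= h1 k1.
- by move=> s; rewrite /paste /= ival0 invr_ge0 ler0n mulr0 /F /= hx.
- move=> s; rewrite paste_half//= ival1; last lra.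
  by rewrite (_ : 2 * 1 - 1 = 1) /F' /= ?kz//; lra.
Qed.

Lemma homotopic_inv x y (f g : ipath x y) :
  homotopic f g -> homotopic (path_inv f) (path_inv g).
Proof.
move=> [h [ch h0 h1 hx hy]]; exists (fun ts => h (reverse ts.1, ts.2)); split=> /=.
- apply: (@continuous_compT _ _ _ (fun ts => (reverse ts.1, ts.2)) h) => //.
  apply: continuous_pair; last exact: continuous_snd.
  by apply: (continuous_compT _ reverse_continuous); exact: continuous_fst.
- by move=> t; rewrite h0.
- by move=> t; rewrite h1.
- by move=> s; rewrite reverse0 hy.
- by move=> s; rewrite reverse1 hx.
Qed.

(* two paths that factor through a third one via functions on the interval
   with the same end points are homotopic *)
Lemma homotopic_reparam x y x' y' (p : ipath x' y') (f g : ipath x y) (a b : I -> R) :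
  continuous a -> continuous b ->
  (forall t, f t = p (clampI (a t))) -> (forall t, g t = p (clampI (b t))) ->
  a zero = b zero -> a one = b one -> homotopic f g.
Proof.
move=> ca cb fa gb a0 a1.
pose l (ts : I * I) := a ts.1 + ival ts.2 * (b ts.1 - a ts.1).
have cl : continuous l.
  have c1 : continuous (fun ts : I * I => a ts.1).
    by apply: (continuous_compT _ ca); exact: continuous_fst.
  have c2 : continuous (fun ts : I * I => b ts.1).
    by apply: (continuous_compT _ cb); exact: continuous_fst.
  have c3 : continuous (fun ts : I * I => ival ts.2).
    by apply: (continuous_compT _ (@ival_continuous R)); exact: continuous_snd.
  move=> ts; apply: cvgD; first exact: c1.
  by apply: cvgM; [exact: c3|apply: cvgB; [exact: c2|exact: c1]].
exists (fun ts => p (clampI (l ts))); split=> /=.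
- apply: (@continuous_compT _ _ _ (fun ts => clampI (l ts)) p).
    exact: (continuous_compT cl (@clampI_continuous R)).
  exact: cts_fun.
- by move=> t; rewrite /l /= ival0 mul0r addr0 fa.
- by move=> t; rewrite /l /= ival1 mul1r addrC subrK gb.
- by move=> s; rewrite /l /= a0 subrr mulr0 addr0 -a0 -fa path_zero.
- by move=> s; rewrite /l /= a1 subrr mulr0 addr0 -a1 -fa path_one.
Qed.

End paths.

Section path_groupoid_laws.
Variables (R : realType) (X : topologicalType).
Local Notation I := (unitI R).
Implicit Types x y z : X.

Lemma homotopic_clamp x y x' y' (p : ipath R x' y') (f g : ipath R x y) (a b : I -> R) :
  continuous a -> continuous b ->
  (forall t, f t = p (clampI (a t))) -> (forall t, g t = p (clampI (b t))) ->
  clampI (a zero) = clampI (b zero) -> clampI (a one) = clampI (b one) ->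
  homotopic f g.
Proof.
move=> ca cb fa gb a0 a1.
have cc (c : I -> R) : continuous c -> continuous (fun t => ival (clampI (c t))).
  move=> c_c; apply: (@continuous_compT _ _ _ (fun t => clampI (c t)) (@ival R)).
    exact: (continuous_compT c_c (@clampI_continuous R)).
  exact: ival_continuous.
apply: (@homotopic_reparam R X x y x' y' p f g _ _ (cc _ ca) (cc _ cb)).
- by move=> t; rewrite ivalK.
- by move=> t; rewrite ivalK.
- by rewrite a0.
- by rewrite a1.
Qed.

Lemma path_comp_clamp1 x y z (f : ipath R x y) (g : ipath R y z) r :
  0 <= r <= 2^-1 -> path_comp f g (clampI r) = f (clampI (2 * r)).
Proof.
move=> r2; have rr : ival (clampI r) = r by rewrite clampI_id//; lra.
by rewrite concat_first rr//; lra.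
Qed.

Lemma path_comp_clamp2 x y z (f : ipath R x y) (g : ipath R y z) r :
  2^-1 <= r <= 1 -> path_comp f g (clampI r) = g (clampI (2 * r - 1)).
Proof.
move=> r2; have rr : ival (clampI r) = r by rewrite clampI_id//; lra.
by rewrite concat_second rr//; lra.
Qed.

Lemma affine_continuous (a b : R) : continuous (fun t : I => a * ival t + b).
Proof.
move=> t; apply: (@continuousD R R _ (fun t => a * ival t) (fun=> b)).
  by apply: (@continuousM R I (fun=> a) (@ival R));
    [exact: cst_continuous|exact: ival_continuous].
exact: cst_continuous.
Qed.

Lemma path_comp_eq x y z (f : ipath R x y) (g : ipath R y z) (F : I -> X) :
  (forall t, ival t <= 2^-1 -> f (clampI (2 * ival t)) = F t) ->
  (forall t, 2^-1 <= ival t -> g (clampI (2 * ival t - 1)) = F t) ->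
  forall t, path_comp f g t = F t.
Proof.
move=> F1 F2 t; have [t2|/ltW t2] := leP (ival t) 2^-1.
  by rewrite concat_first// F1.
by rewrite concat_second// F2.
Qed.

Lemma path_idE x t : path_id R x t = x. Proof. by []. Qed.

Lemma path_invE x y (f : ipath R x y) t : path_inv f t = f (reverse t).
Proof. by []. Qed.

Lemma clampI0 : clampI 0 = zero :> I. Proof. by []. Qed.
Lemma clampI1 : clampI 1 = one :> I. Proof. by []. Qed.

Let range01 (t : I) : 0 <= ival t <= 1.
Proof. by rewrite ival_ge0 ival_le1. Qed.

Lemma path_comp1f x y (f : ipath R x y) : homotopic (path_comp (path_id R x) f) f.
Proof.
apply: (@homotopic_clamp _ _ _ _ f _ _ (fun t => 2 * ival t + - 1) (fun t => 1 * ival t + 0)).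
- exact: affine_continuous.
- exact: affine_continuous.
- apply: path_comp_eq => t t2 //.
  by rewrite path_idE clampI_le0 ?clampI0 ?path_zero//; lra.
- by move=> t; rewrite mul1r addr0 ivalK.
- by rewrite ival0 mul1r addr0 clampI_le0//; lra.
- by rewrite ival1; congr clampI; lra.
Qed.

Lemma path_compf1 x y (f : ipath R x y) : homotopic (path_comp f (path_id R y)) f.
Proof.
apply: (@homotopic_clamp _ _ _ _ f _ _ (fun t => 2 * ival t + 0) (fun t => 1 * ival t + 0)).
- exact: affine_continuous.
- exact: affine_continuous.
- apply: path_comp_eq => t t2; first by rewrite addr0.
  by rewrite path_idE clampI_ge1 ?clampI1 ?path_one//; lra.
- by move=> t; rewrite mul1r addr0 ivalK.
- by rewrite ival0; congr clampI; lra.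
- by rewrite ival1 !addr0 mul1r clampI_ge1//; lra.
Qed.

Lemma clamp_reverse r : 0 <= r <= 1 -> reverse (clampI r) = clampI (1 - r) :> I.
Proof. by move=> r01; rewrite /reverse clampI_id. Qed.

Lemma path_compfV x y (f : ipath R x y) :
  homotopic (path_comp f (path_inv f)) (path_id R x).
Proof.
apply: (@homotopic_clamp _ _ _ _ f _ _
  (fun t => Num.min (2 * ival t + 0) (- 2 * ival t + 2)) (fun t => 0 * ival t + 0)).
- by move=> t; apply: (@continuous_min R I _ _ t); exact: affine_continuous.
- exact: affine_continuous.
- apply: path_comp_eq => t t2; have t01 := range01 t.
    by rewrite min_l; [rewrite addr0|lra].
  rewrite path_invE clamp_reverse; last lra.
  by rewrite min_r; [congr (f (clampI _)); lra|lra].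
- by move=> t; rewrite path_idE mul0r addr0 clampI0 path_zero.
- by rewrite ival0 min_l; [congr clampI; lra|lra].
- by rewrite ival1 min_r; [congr clampI; lra|lra].
Qed.

Lemma path_compVf x y (f : ipath R x y) :
  homotopic (path_comp (path_inv f) f) (path_id R y).
Proof.
apply: (@homotopic_clamp _ _ _ _ f _ _
  (fun t => Num.max (- 2 * ival t + 1) (2 * ival t + - 1)) (fun t => 0 * ival t + 1)).
- by move=> t; apply: (@continuous_max R I _ _ t); exact: affine_continuous.
- exact: affine_continuous.
- apply: path_comp_eq => t t2; have t01 := range01 t.
    rewrite path_invE clamp_reverse; last lra.
    by rewrite max_l; [congr (f (clampI _)); lra|lra].
  by rewrite max_r//; lra.
- by move=> t; rewrite path_idE mul0r add0r clampI1 path_one.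
- by rewrite ival0 max_l; [congr clampI; lra|lra].
- by rewrite ival1 max_r; [congr clampI; lra|lra].
Qed.

Lemma path_compA x y z w (f : ipath R x y) (g : ipath R y z) (h : ipath R z w) :
  homotopic (path_comp f (path_comp g h)) (path_comp (path_comp f g) h).
Proof.
set p := path_comp f (path_comp g h).
apply: (@homotopic_clamp _ _ _ _ p _ _ (fun t => 1 * ival t + 0)
  (fun t => Num.min (2 * ival t + 0) (Num.min (1 * ival t + 4^-1) (2^-1 * ival t + 2^-1)))).
- exact: affine_continuous.
- move=> t; apply: (@continuous_min R I _ _ t); first exact: affine_continuous.
  by apply: (@continuous_min R I _ _ t); exact: affine_continuous.
- by move=> t; rewrite mul1r addr0 ivalK.
- apply: path_comp_eq => t t2; have t01 := range01 t; last first.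
    rewrite [Num.min (1 * _ + _) _]min_r; last lra.
    rewrite min_r; last lra.
    rewrite /p path_comp_clamp2; last lra.
    by rewrite path_comp_clamp2; [congr (h (clampI _)); lra|lra].
  rewrite [Num.min (1 * _ + _) _]min_l; last lra.
  have [t4|/ltW t4] := leP (ival t) 4^-1.
    rewrite min_l; last lra.
    rewrite /p !path_comp_clamp1; [|lra|lra].
    by congr (f (clampI _)); lra.
  rewrite min_r; last lra.
  rewrite path_comp_clamp2; last lra.
  rewrite /p path_comp_clamp2; last lra.
  by rewrite path_comp_clamp1; [congr (g (clampI _)); lra|lra].
- rewrite ival0 [Num.min (1 * _ + _) _]min_l; last lra.
  by rewrite min_l; [congr clampI; lra|lra].
- rewrite ival1 [Num.min (1 * _ + _) _]min_r; last lra.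
  by rewrite min_r; [congr clampI; lra|lra].
Qed.

End path_groupoid_laws.

Section fundamental_groupoid.
Variables (R : realType) (X : topologicalType).
Implicit Types x y z : X.

Section path_classes.
Variables x y : X.

Definition homotopic_rel (f g : ipath R x y) : bool := `[< homotopic f g >].

Lemma homotopic_rel_refl : reflexive homotopic_rel.
Proof. by move=> f; apply/asboolP; exact: homotopic_refl. Qed.
Lemma homotopic_rel_sym : symmetric homotopic_rel.
Proof. by move=> f g; apply/asboolP/asboolP; exact: homotopic_sym. Qed.
Lemma homotopic_rel_trans : transitive homotopic_rel.
Proof.
by move=> g f h /asboolP fg /asboolP gh; apply/asboolP; exact: homotopic_trans gh.
Qed.

Canonical homotopic_equiv := EquivRel homotopic_rel
  homotopic_rel_refl homotopic_rel_sym homotopic_rel_trans.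

Definition path_class := {eq_quot homotopic_rel}.

Definition pclass (f : ipath R x y) : path_class := \pi f.

Lemma pclassP f g : pclass f = pclass g <-> homotopic f g.
Proof. by split=> [/eqmodP/asboolP//|fg]; apply/eqmodP/asboolP. Qed.

Lemma pclass_repr (c : path_class) : pclass (repr c) = c.
Proof. exact: reprK. Qed.

Lemma repr_pclass f : homotopic (repr (pclass f)) f.
Proof. by apply/pclassP; rewrite pclass_repr. Qed.

End path_classes.

Definition class_comp x y z (c : path_class x y) (d : path_class y z) :
  path_class x z := pclass (path_comp (repr c) (repr d)).

Definition class_inv x y (c : path_class x y) : path_class y x :=
  pclass (path_inv (repr c)).

Definition class_id x : path_class x x := pclass (path_id R x).

Lemma class_compE x y z (f : ipath R x y) (g : ipath R y z) :
  class_comp (pclass f) (pclass g) = pclass (path_comp f g).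
Proof. by apply/pclassP/homotopic_comp; exact: repr_pclass. Qed.

Lemma class_invE x y (f : ipath R x y) : class_inv (pclass f) = pclass (path_inv f).
Proof. by apply/pclassP/homotopic_inv; exact: repr_pclass. Qed.

Lemma class_compA x y z w (c : path_class x y) (d : path_class y z) (e : path_class z w) :
  class_comp c (class_comp d e) = class_comp (class_comp c d) e.
Proof.
rewrite -(pclass_repr c) -(pclass_repr d) -(pclass_repr e) !class_compE.
by apply/pclassP/path_compA.
Qed.

Lemma class_comp1f x y (c : path_class x y) : class_comp (class_id x) c = c.
Proof.
by rewrite -(pclass_repr c) class_compE; apply/pclassP/path_comp1f.
Qed.

Lemma class_compf1 x y (c : path_class x y) : class_comp c (class_id y) = c.
Proof.
by rewrite -(pclass_repr c) class_compE; apply/pclassP/path_compf1.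
Qed.

Lemma class_compfV x y (c : path_class x y) : class_comp c (class_inv c) = class_id x.
Proof.
by rewrite -(pclass_repr c) class_invE class_compE; apply/pclassP/path_compfV.
Qed.

Lemma class_compVf x y (c : path_class x y) : class_comp (class_inv c) c = class_id y.
Proof.
by rewrite -(pclass_repr c) class_invE class_compE; apply/pclassP/path_compVf.
Qed.

Definition pi1 (A : set X) : groupoid :=
  @Groupoid A (fun a b => path_class (set_val a) (set_val b))
    (fun a => class_id (set_val a))
    (fun a b c => @class_comp (set_val a) (set_val b) (set_val c))
    (fun a b => @class_inv (set_val a) (set_val b))
    (fun a b c d => @class_compA (set_val a) (set_val b) (set_val c) (set_val d))
    (fun a b => @class_comp1f (set_val a) (set_val b))
    (fun a b => @class_compf1 (set_val a) (set_val b))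
    (fun a b => @class_compfV (set_val a) (set_val b))
    (fun a b => @class_compVf (set_val a) (set_val b)).

End fundamental_groupoid.

Section natural_morphism.
Variables (R : realType) (X : topologicalType).
Local Notation I := (unitI R).

Lemma line_continuous (u : continuousType I X) :
  continuous (fun t : icube R 1 => u (t ord0)).
Proof.
apply: (@continuous_compT _ _ _ (fun t : icube R 1 => t ord0) u).
  exact: ptws_proj_continuous.
exact: cts_fun.
Qed.

Definition line (u : continuousType I X) : scube R X 1 := mkcts (line_continuous (u := u)).

Definition line_chain (u : continuousType I X) : chains R X 1 := cube_chain (line u).

Lemma line_chain_cst (u : continuousType I X) x : (forall s, u s = x) -> line_chain u = 0.
Proof.
move=> ux; apply: zproj_gen; exists (line u) => //.
by apply: (@independent_degenerate _ _ _ _ ord0) => s t _; rewrite /= /mkcts !ux.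
Qed.

Section square.
Variables (h : I * I -> X) (ch : continuous h).

Lemma square_continuous : continuous (fun t : icube R 2 => h (t ord0, t ord_max)).
Proof.
apply: (@continuous_compT _ _ _ (fun t : icube R 2 => (t ord0, t ord_max)) h) => //.
by apply: continuous_pair; exact: ptws_proj_continuous.
Qed.

Definition square : scube R X 2 := mkcts square_continuous.

Lemma square_boundary (u0 u1 v0 v1 : continuousType I X) :
  (forall s, h (zero, s) = u0 s) -> (forall s, h (one, s) = u1 s) ->
  (forall t, h (t, zero) = v0 t) -> (forall t, h (t, one) = v1 t) ->
  boundary (cube_chain square) =
  (line_chain v0 - line_chain v1) - (line_chain u0 - line_chain u1).
Proof.
move=> hu0 hu1 hv0 hv1; rewrite boundaryE big_ord_recl big_ord1.
rewrite expr1 expr2 mulrNN mulr1 mulrN1z mulr1z addrC.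
have i00 a (t : icube R 1) : insert ord0 a t ord0 = a.
  by rewrite /insert unlift_none.
have i01 a (t : icube R 1) : insert ord0 a t ord_max = t ord0.
  rewrite /insert; case: unliftP => [j _|/(congr1 val)//].
  by rewrite (ord1 j).
have i10 a (t : icube R 1) : insert ord_max a t ord0 = t ord0.
  rewrite /insert; case: unliftP => [j _|/(congr1 val)//].
  by rewrite (ord1 j).
have i11 a (t : icube R 1) : insert ord_max a t ord_max = a.
  by rewrite /insert unlift_none.
have -> : fintype.lift ord0 ord0 = ord_max :> 'I_2 by exact: val_inj.
have -> : face ord0 zero square = line u0.
  by apply/continuousEP => t; rewrite /= /mkcts /= i00 i01 hu0.
have -> : face ord0 one square = line u1.
  by apply/continuousEP => t; rewrite /= /mkcts /= i00 i01 hu1.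
have -> : face ord_max zero square = line v0.
  by apply/continuousEP => t; rewrite /= /mkcts /= i10 i11 hv0.
have -> // : face ord_max one square = line v1.
by apply/continuousEP => t; rewrite /= /mkcts /= i10 i11 hv1.
Qed.

End square.

Lemma line_chain_homotopic x y (f g : ipath R x y) : homotopic f g ->
  exists c : chains R X 2, boundary c = line_chain f - line_chain g.
Proof.
move=> [h [ch h0 h1 hx hy]]; exists (cube_chain (square ch)).
rewrite (@square_boundary h ch (cst x) (cst y) f g hx hy h0 h1).
by rewrite !(@line_chain_cst (cst _) _ (fun=> erefl)) !subr0.
Qed.

Lemma line_chain_comp x y z (f : ipath R x y) (g : ipath R y z) :
  exists c : chains R X 2,
    boundary c = line_chain (path_comp f g) - (line_chain f + line_chain g).
Proof.
pose l (ts : I * I) : R := ival ts.1 + (1 - ival ts.1) * (2^-1 * ival ts.2).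
have cl : continuous l.
  have c1 : continuous (fun ts : I * I => ival ts.1).
    by apply: (continuous_compT _ (@ival_continuous R)); exact: continuous_fst.
  have c2 : continuous (fun ts : I * I => ival ts.2).
    by apply: (continuous_compT _ (@ival_continuous R)); exact: continuous_snd.
  move=> ts; apply: (@continuousD R R _ (fun ts : I * I => ival ts.1)); first exact: c1.
  apply: (@continuousM R _ (fun ts : I * I => 1 - ival ts.1) (fun ts => 2^-1 * ival ts.2)).
    apply: (@continuousB R R _ (fun=> 1) (fun ts : I * I => ival ts.1)); last exact: c1.
    exact: cst_continuous.
  apply: (@continuousM R _ (fun=> 2^-1) (fun ts : I * I => ival ts.2)); last exact: c2.
  exact: cst_continuous.
have ch : continuous (fun ts => path_comp f g (clampI (l ts))).
  apply: (@continuous_compT _ _ _ (fun ts => clampI (l ts)) (path_comp f g)).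
    exact: (continuous_compT cl (@clampI_continuous R)).
  exact: cts_fun.
exists (cube_chain (square ch)).
rewrite (@square_boundary _ ch f (cst z) (path_comp f g) g).
- rewrite (@line_chain_cst (cst _) _ (fun=> erefl)) subr0 opprD addrA.
  by rewrite addrAC.
- move=> s; rewrite /l /= ival0 subr0 mul1r add0r.
  have s0 := ival_ge0 s; have s1 := ival_le1 s.
  rewrite path_comp_clamp1; last lra.
  by rewrite mulVKf ?pnatr_eq0// ivalK.
- by move=> s; rewrite /l /= ival1 subrr mul0r addr0 clampI1 path_one.
- by move=> t; rewrite /l /= ival0 !mulr0 addr0 ivalK.
- move=> t; rewrite /l /= ival1.
  have t0 := ival_ge0 t; have t1 := ival_le1 t.
  rewrite path_comp_clamp2; last lra.
  by rewrite (_ : 2 * _ - 1 = ival t) ?ivalK//; lra.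
Qed.

Variable A : set X.

Lemma line_cycle (a b : A) (f : ipath R (set_val a) (set_val b)) :
  rel_boundary (rel_chain A (line_chain f)) = 0.
Proof.
rewrite rel_boundaryE boundaryE big_ord1 /rel_chain raddfMz raddfB /=.
have end0 (e : I) : A (f e) -> zproj (@subspace_chains R X A 0)
    (cube_chain (face ord0 e (line f))) = 0.
  move=> Afe; apply: zproj_gen; exists (face ord0 e (line f)) => // t /=.
  by rewrite /mkcts /= /mkcts /= /insert unlift_none.
by rewrite !end0 ?subrr ?mul0rz// ?path_zero ?path_one; exact: set_valP.
Qed.

Definition path_cycle (a b : A) (f : ipath R (set_val a) (set_val b)) :
  zker (@rel_boundary R X A 0) := to_zker (line_cycle f).

Definition path_homology_class (a b : A) (f : ipath R (set_val a) (set_val b)) :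
  H1 R A := zproj _ (path_cycle f).

Lemma path_homology_class_homotopic (a b : A) (f g : ipath R (set_val a) (set_val b)) :
  homotopic f g -> path_homology_class f = path_homology_class g.
Proof.
move=> /line_chain_homotopic[c bc]; apply/zprojP; apply: sub_generated.
by exists (rel_chain A c); rewrite [RHS]raddfB /= rel_boundaryE bc /rel_chain raddfB.
Qed.

Lemma path_homology_class_comp (a b c : A) (f : ipath R (set_val a) (set_val b))
    (g : ipath R (set_val b) (set_val c)) :
  path_homology_class (path_comp f g) = path_homology_class f + path_homology_class g.
Proof.
have [k bk] := line_chain_comp f g.
rewrite /path_homology_class -raddfD; apply/zprojP; apply: sub_generated.
by exists (rel_chain A k); rewrite [RHS]raddfB /= rel_boundaryE bk /rel_chain raddfB /= !raddfD.
Qed.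

Lemma path_homology_class_id (a : A) :
  path_homology_class (path_id R (set_val a)) = 0.
Proof.
apply: (addIr (path_homology_class (path_id R (set_val a)))).
rewrite add0r -path_homology_class_comp; apply: path_homology_class_homotopic.
exact: path_comp1f.
Qed.

Definition class_homology (a b : pi1 R A) (c : ghom a b) : H1 R A :=
  path_homology_class (repr c).

Lemma class_homologyE (a b : pi1 R A) (f : ipath R (set_val a) (set_val b)) :
  @class_homology a b (pclass f) = path_homology_class f.
Proof. by apply: path_homology_class_homotopic; exact: repr_pclass. Qed.

Lemma class_homology_id (a : pi1 R A) : class_homology (gid a) = 0.
Proof. by rewrite class_homologyE path_homology_class_id. Qed.

Lemma class_homology_comp (a b c : pi1 R A) (f : ghom a b) (g : ghom b c) :
  class_homology (gcomp f g) = class_homology f + class_homology g.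
Proof. by rewrite class_homologyE path_homology_class_comp. Qed.

Definition pi1_to_H1 : groupoid_morphism (pi1 R A) (groupoid_of_zmod (H1 R A)) :=
  @GroupoidMorphism (pi1 R A) (groupoid_of_zmod (H1 R A)) (fun=> tt)
    class_homology class_homology_id class_homology_comp.

(* the morphism that [pi1_to_H1] induces on the universal abelianisation *)
Definition natural_morphism : {additive totab (pi1 R A) -> H1 R A} :=
  totab_lift pi1_to_H1.

Lemma natural_morphismE (a b : A) (f : ipath R (set_val a) (set_val b)) :
  natural_morphism (@gval _ _ (totab_unit (pi1 R A)) a b (pclass f)) =
  path_homology_class f.
Proof. by rewrite /natural_morphism /= totab_liftE -class_homologyE. Qed.

Definition totally_path_disconnected :=
  forall x y (f : ipath R x y), (forall t, A (f t)) -> forall s t, f s = f t.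

Definition path_component x : set X := [set y | inhabited (ipath R x y)].

Definition meets_path_components := forall x, A `&` path_component x !=set0.

End natural_morphism.

(* Main.v *)
Require Import Defs.
From mathcomp Require Import all_boot all_order all_algebra.
From mathcomp Require Import all_classical reals topology normedtype.
From HB Require Import structures.
From mathcomp Require Import homotopy freeg lra.

(** This is the Hurewicz argument for groupoids, with an explicit inverse to
    the natural morphism.

    Choose for each point x of X a path g x from x to a point e x of A, constant
    when x lies in A.  A path f from x to y then yields an arrow of the
    fundamental groupoid on A, namely the class of (g x)^-1 . f . g y, from e x to
    e y, whose image in the abelianisation is [based_arrow f].  This extends to
    an additive map on 1-chains.  Constant paths go to 0 because they are
    idempotent up to homotopy, and so do all paths in A: this is where total path
    disconnectedness enters.  Boundaries go to 0 because the two ways around a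
    singular square are homotopic ([square_homotopic]).  The result is a map
    [homology_based_arrow] from H_1(X,A) to the abelianisation.

    It is a left inverse of the natural morphism, since conjugating by constant
    paths does not change the class of a path between points of A.

    For the other composite, sending x to the 1-cube g x defines a map from
    relative 0-chains to relative 1-chains which is a contraction up to sign:
    the boundary of g x is e x - x, that is -x modulo A.  Therefore
    c |-> c + g(boundary c) is a projection P of the relative 1-chains onto the
    relative 1-cycles ([cycle_projection]).  On a path f from x to y it gives
    f + g y - g x, which is homologous to the path (g x)^-1 . f . g y.  So the
    natural morphism composed with the arrow map is c |-> [P c] on generators,
    hence on all chains ([natural_based_arrow]), and on a cycle P is the
    identity. *)

(** * Additive maps and singular cubes of dimension at most 2 *)

Section chain_maps.
Set Implicit Arguments.
Unset Strict Implicit.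
Import GRing.Theory.
Local Open Scope classical_set_scope.
Local Open Scope ring_scope.

Lemma generated_id (V : zmodType) (S : set V) :
  subgroup S -> generated S = S.
Proof.
by move=> gS; apply/seteqP; split; [exact: smallest_sub|exact: sub_generated].
Qed.

Lemma zquot_ext (V W : zmodType) (S : set V) (f g : {additive zquot S -> W}) :
  (forall v, f (zproj S v) = g (zproj S v)) -> f =1 g.
Proof. by move=> fg x; have [v <-] := zproj_surj x. Qed.

Lemma rel_chains_ext (R : realType) (X : topologicalType) (A : set X) n
    (W : zmodType) (f g : {additive rel_chains R A n -> W}) :
  (forall k : scube R X n,
    f (rel_chain A (cube_chain k)) = g (rel_chain A (cube_chain k))) -> f =1 g.
Proof.
move=> fg; apply: zquot_ext => c; have [D <-] := zproj_surj c.
exact: (@free_ext _ _ (f \o (zproj _ \o zproj _)) (g \o (zproj _ \o zproj _)) fg D).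
Qed.

Variables (R : realType) (X : topologicalType).
Local Notation I := (unitI R).

Definition point (x : X) : chains R X 0 := cube_chain (mkcts (@cst_continuous (icube R 0) X x)).

Lemma icube0_eq (s t : icube R 0) : s = t.
Proof. by apply/funext => -[]. Qed.

Definition unline (k : scube R X 1) : I -> X := fun s => k (fun=> s).

Lemma unline_continuous (k : scube R X 1) : continuous (unline k).
Proof.
apply: (@continuous_compT I (icube R 1) X (fun s _ => s) k); last exact: cts_fun.
by apply: ptws_continuous => i t; exact: cvg_id.
Qed.

Definition path_of (u : I -> X) (cu : continuous u) : ipath R (u zero) (u one) :=
  mk_path cu (erefl (u zero)) (erefl (u one)).

Lemma line_unline (k : scube R X 1) : line (path_of (@unline_continuous k)) = k.
Proof.
apply/continuousEP => t; rewrite /= /mkcts /= /mk_path /unline.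
by congr (k _); apply/funext => j; rewrite (ord1 j).
Qed.

(** Singular 1-cubes are indexed by [icube R 1], paths by the unit interval; this
    passes from the former to the latter, where concatenation is available. *)
Lemma cube_chain_path (k : scube R X 1) :
  cube_chain k = line_chain (path_of (@unline_continuous k)).
Proof. by rewrite /line_chain line_unline. Qed.

Definition pair_icube (st : I * I) : icube R 2 :=
  fun i => if i == ord0 then st.1 else st.2.

Definition unsquare (k : scube R X 2) : I * I -> X := k \o pair_icube.

Lemma unsquare_continuous (k : scube R X 2) : continuous (unsquare k).
Proof.
apply: (@continuous_compT _ _ _ pair_icube k); last exact: cts_fun.
apply: ptws_continuous => i; rewrite /pair_icube; case: (i == ord0).
  exact: continuous_fst.
exact: continuous_snd.
Qed.

Lemma square_unsquare (k : scube R X 2) : square (@unsquare_continuous k) = k.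
Proof.
apply/continuousEP => t; rewrite /= /mkcts /= /unsquare.
congr (k _); apply/funext => j; rewrite /pair_icube; case: eqVneq => [->//|].
by case: j => -[|[|[]]]//= j2 _; congr (t _); apply: val_inj.
Qed.

Lemma boundary_line (x y : X) (f : ipath R x y) :
  boundary (line_chain f) = point y - point x.
Proof.
rewrite boundaryE big_ord1 expr1 mulrN1z opprB.
have faceE e z : f e = z -> cube_chain (face ord0 e (line f)) = point z.
  move=> <-; congr cube_chain; apply/continuousEP => t.
  by rewrite /= /mkcts /= /mkcts /= /insert unlift_none.
by rewrite (faceE one y) ?(faceE zero x)// ?path_one ?path_zero.
Qed.

End chain_maps.

(** * The homotopy given by a square *)

Section squares.
Set Implicit Arguments.
Unset Strict Implicit.
Import Order.TTheory GRing.Theory Num.Theory numFieldNormedType.Exports.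
Local Open Scope classical_set_scope.
Local Open Scope ring_scope.
Variables (R : realType) (X : topologicalType).
Local Notation I := (unitI R).

Lemma homotopic_eq (x y : X) (f g : ipath R x y) : f =1 g -> homotopic f g.
Proof. by move=> /path_eqP ->; exact: homotopic_refl. Qed.

(** The square is convex: the straight-line homotopy, in each coordinate, from
    (a1, a2) to (b1, b2) stays inside it. *)
Lemma homotopic_square (h : I * I -> X) (a1 a2 b1 b2 : I -> I) (x y : X)
    (f g : ipath R x y) : continuous h ->
  continuous a1 -> continuous a2 -> continuous b1 -> continuous b2 ->
  (forall t, f t = h (a1 t, a2 t)) -> (forall t, g t = h (b1 t, b2 t)) ->
  a1 zero = b1 zero -> a2 zero = b2 zero -> a1 one = b1 one -> a2 one = b2 one ->
  homotopic f g.
Proof.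
move=> ch ca1 ca2 cb1 cb2 fa gb a10 a20 a11 a21.
pose l (a b : I -> I) (ts : I * I) : I :=
  clampI (ival (a ts.1) + ival ts.2 * (ival (b ts.1) - ival (a ts.1))).
have cl a b : continuous a -> continuous b -> continuous (l a b).
  move=> ca cb.
  have cfst (c : I -> I) : continuous c -> continuous (fun ts : I * I => ival (c ts.1) : R).
    move=> cc; apply: (continuous_compT _ (@ival_continuous R)).
    by apply: (continuous_compT _ cc); exact: continuous_fst.
  apply: (continuous_compT _ (@clampI_continuous R)) => ts.
  apply: cvgD; first exact: (cfst _ ca).
  apply: cvgM; last by apply: cvgB; [exact: (cfst _ cb)|exact: (cfst _ ca)].
  by apply: (continuous_compT _ (@ival_continuous R)); exact: continuous_snd.
have l0 a b t : l a b (t, zero) = a t by rewrite /l /= ival0 mul0r addr0 ivalK.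
have l1 a b t : l a b (t, one) = b t.
  by rewrite /l /= ival1 mul1r addrC subrK ivalK.
have lE a b t s : a t = b t -> l a b (t, s) = a t.
  by move=> ab; rewrite /l /= ab subrr mulr0 addr0 ivalK.
exists (fun ts => h (l a1 b1 ts, l a2 b2 ts)); split=> /=.
- apply: (continuous_compT _ ch).
  by apply: continuous_pair; exact: cl.
- by move=> t; rewrite !l0 fa.
- by move=> t; rewrite !l1 gb.
- by move=> s; rewrite !lE// -fa path_zero.
- by move=> s; rewrite !lE// -fa path_one.
Qed.

Lemma square_homotopic (h : I * I -> X) x00 x01 x10 x11
    (v0 : ipath R x00 x10) (v1 : ipath R x01 x11)
    (u0 : ipath R x00 x01) (u1 : ipath R x10 x11) : continuous h ->
  (forall s, h (zero, s) = u0 s) -> (forall s, h (one, s) = u1 s) ->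
  (forall t, h (t, zero) = v0 t) -> (forall t, h (t, one) = v1 t) ->
  homotopic (path_comp v0 u1) (path_comp u0 v1).
Proof.
move=> ch hu0 hu1 hv0 hv1.
(* At double speed, [first] runs through the interval and then waits, while
   [second] waits and then runs: (first, second) and (second, first) go round the
   square along its two halves. *)
pose first (t : I) : I := clampI (2 * ival t + 0).
pose second (t : I) : I := clampI (2 * ival t + -1).
have cf : continuous first.
  by apply: (continuous_compT _ (@clampI_continuous R)); exact: affine_continuous.
have cs : continuous second.
  by apply: (continuous_compT _ (@clampI_continuous R)); exact: affine_continuous.
have f1 t : 2^-1 <= ival t -> first t = one.
  by move=> t2; rewrite /first clampI_ge1 ?clampI1//; lra.
have s0 t : ival t <= 2^-1 -> second t = zero.
  by move=> t2; rewrite /second clampI_le0 ?clampI0//; lra.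
have f0 t : ival t <= 2^-1 -> clampI (2 * ival t) = first t by rewrite /first addr0.
have i0 : ival (zero : I) <= 2^-1 by rewrite ival0; lra.
have i1 : 2^-1 <= ival (one : I) by rewrite ival1; lra.
have fs0 : first zero = second zero.
  by rewrite (s0 zero)// /first ival0 mulr0 addr0 clampI0.
have fs1 : first one = second one.
  by rewrite (f1 one)// /second ival1 clampI_ge1 ?clampI1//; lra.
apply: (@homotopic_square h first second second first) => //.
- by apply: path_comp_eq => t t2; [rewrite f0// s0// hv0|rewrite f1// hu1].
- by apply: path_comp_eq => t t2; [rewrite f0// s0// hu0|rewrite f1// hv1].
Qed.

End squares.

(** * The abelianised arrow of a chain *)

Section inverse.
Set Implicit Arguments.
Unset Strict Implicit.
Import GRing.Theory.
Local Open Scope classical_set_scope.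
Local Open Scope ring_scope.
Variables (R : realType) (X : topologicalType) (A : set X).
Hypothesis Atpd : totally_path_disconnected R A.
Variables (e : X -> A) (g : forall x, ipath R x (set_val (e x))).
Hypothesis gA : forall x, A x -> forall t, g x t = x.
Local Notation I := (unitI R).
Local Notation T := (totab (pi1 R A)).
Implicit Types x y : X.

Definition based_arrow x y (f : ipath R x y) : T :=
  @totab_arrow (pi1 R A) (e x) (e y)
    (pclass (path_comp (path_inv (g x)) (path_comp f (g y)))).

Lemma based_arrow_homotopic x y (f f' : ipath R x y) :
  homotopic f f' -> based_arrow f = based_arrow f'.
Proof.
move=> ff'; congr totab_arrow; apply/pclassP.
apply: homotopic_comp; first exact: homotopic_refl.
by apply: homotopic_comp => //; exact: homotopic_refl.
Qed.

Lemma based_arrow_comp x y (z : X) (f : ipath R x y) (f' : ipath R y z) :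
  based_arrow (path_comp f f') = based_arrow f + based_arrow f'.
Proof.
rewrite /based_arrow -totab_comp /=; congr totab_arrow.
rewrite -!class_compE -!class_invE -!class_compA.
by rewrite (class_compA (pclass (g y))) class_compfV class_comp1f.
Qed.

(** The end points of a path occur in its type; this is what allows a path to be
    replaced by the same function seen with other, equal, end points. *)
Lemma based_arrow_eq x y x' y' (f : ipath R x y) (f' : ipath R x' y') :
  f =1 f' -> based_arrow f = based_arrow f'.
Proof.
move=> ff'.
have xx' : x = x' by rewrite -(path_zero (s:=f)) -(path_zero (s:=f')) ff'.
have yy' : y = y' by rewrite -(path_one (s:=f)) -(path_one (s:=f')) ff'.
by subst x' y'; apply/based_arrow_homotopic/homotopic_eq.
Qed.

(** A constant path is homotopic to its concatenation with itself, so its value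
    equals twice that value. *)
Lemma based_arrow_cst x y (f : ipath R x y) z : (forall t, f t = z) ->
  based_arrow f = 0.
Proof.
move=> fz; rewrite (based_arrow_eq (f' := path_id R z))//.
apply: (addIr (based_arrow (path_id R z))).
rewrite add0r -based_arrow_comp.
by apply: based_arrow_homotopic; exact: path_comp1f.
Qed.

(** The chosen paths at points of A are constant, so they are identities of the
    fundamental groupoid and conjugating by them changes nothing. *)
Lemma based_arrow_vertex (a b : A) (f : ipath R (set_val a) (set_val b)) :
  based_arrow f = @totab_arrow (pi1 R A) a b (pclass f).
Proof.
rewrite /based_arrow.
have Aa : A (set_val a) := set_valP a; have Ab : A (set_val b) := set_valP b.
have := gA Aa; have := gA Ab.
(* Generalising the chosen paths, then their end points, makes it possible to
   identify e a with a and e b with b inside the types. *)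
move: (g (set_val a)) (g (set_val b)) => p q qb pa.
move: (e (set_val a)) (e (set_val b)) p q qb pa => a' b' p q qb pa.
have aa' : a' = a by apply: val_inj; rewrite -[LHS](path_one (s:=p)) pa.
have bb' : b' = b by apply: val_inj; rewrite -[LHS](path_one (s:=q)) qb.
subst a' b'; congr totab_arrow.
have -> : p = path_id R _ by apply/path_eqP.
have -> : q = path_id R _ by apply/path_eqP.
by rewrite -!class_compE -class_invE -[pclass (path_id R _)]/(class_id R _)
  class_compf1 -[class_inv _]class_comp1f class_compfV class_comp1f.
Qed.

Definition free_based_arrow : {freeg (scube R X 1) / int} -> T :=
  free_lift (fun k => based_arrow (path_of (unline_continuous (k := k)))).
HB.instance Definition _ := GRing.Additive.on free_based_arrow.

Lemma free_based_arrow_degenerate c :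
  @degenerate_chains R X 1 c -> free_based_arrow c = 0.
Proof.
move=> [k [i [k' kk']] <-]; rewrite /free_based_arrow free_liftU.
apply: (@based_arrow_cst _ _ _ (k' (fun=> zero))) => t.
rewrite /= /mk_path /unline kk'; congr (k' _); exact: icube0_eq.
Qed.

Definition chain_based_arrow : chains R X 1 -> T :=
  zquot_lift free_based_arrow_degenerate.
HB.instance Definition _ := GRing.Additive.on chain_based_arrow.

Lemma chain_based_arrow_line x y (f : ipath R x y) :
  chain_based_arrow (line_chain f) = based_arrow f.
Proof.
rewrite /chain_based_arrow zquot_liftE /= /free_based_arrow free_liftU.
exact: based_arrow_eq.
Qed.

Lemma chain_based_arrow_subspace c :
  @subspace_chains R X A 1 c -> chain_based_arrow c = 0.
Proof.
move=> [k Ak <-]; rewrite cube_chain_path.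
rewrite (chain_based_arrow_line (path_of (unline_continuous (k := k)))).
by apply: (@based_arrow_cst _ _ _ (unline k zero)) => t; apply: Atpd => s; exact: Ak.
Qed.

Definition rel_based_arrow : rel_chains R A 1 -> T :=
  zquot_lift chain_based_arrow_subspace.
HB.instance Definition _ := GRing.Additive.on rel_based_arrow.

Lemma rel_based_arrow_line x y (f : ipath R x y) :
  rel_based_arrow (rel_chain A (line_chain f)) = based_arrow f.
Proof. by rewrite /rel_based_arrow zquot_liftE; exact: chain_based_arrow_line. Qed.

(** In the boundary (v0 - v1) - (u0 - u1) of a square, v0 + u1 and u0 + v1 are the
    values of the two concatenations around the square, which are homotopic, so
    the four terms cancel. *)
Lemma rel_based_arrow_boundary c : rel_based_arrow (rel_boundary c) = 0.
Proof.
apply: (rel_chains_ext (f := rel_based_arrow \o @rel_boundary R X A 1)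
  (g := \0)) => k /=.
rewrite rel_boundaryE -(square_unsquare k).
pose h := unsquare k; pose ch : continuous h := unsquare_continuous (k := k).
rewrite -[square _]/(square ch).
have cl (s : I) : continuous (fun t => h (t, s)).
  apply: (continuous_compT _ ch); apply: continuous_pair; last exact: cst_continuous.
  by move=> t; exact: cvg_id.
have cr (s : I) : continuous (fun t => h (s, t)).
  apply: (continuous_compT _ ch); apply: continuous_pair; first exact: cst_continuous.
  by move=> t; exact: cvg_id.
pose v0 := path_of (cl zero); pose v1 := path_of (cl one).
pose u0 := path_of (cr zero); pose u1 := path_of (cr one).
rewrite (square_boundary ch (u0 := u0) (u1 := u1) (v0 := v0) (v1 := v1))//.
rewrite /rel_chain !raddfB /= -/(rel_chain A _) !rel_based_arrow_line.
have := based_arrow_homotopic (@square_homotopic R X h _ _ _ _ v0 v1 u0 u1 ch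
  (fun=> erefl) (fun=> erefl) (fun=> erefl) (fun=> erefl)).
rewrite !based_arrow_comp => vu.
by rewrite opprK [- _ + _]addrC addrACA vu -opprD [X in _ - X]addrC subrr.
Qed.

Lemma rel_based_arrow_null_cycle (z : zker (@rel_boundary R X A 0)) :
  [set z : zker (@rel_boundary R X A 0) | exists u, rel_boundary u = val z] z ->
  (rel_based_arrow \o val) z = 0.
Proof. by move=> [u uz] /=; rewrite -uz rel_based_arrow_boundary. Qed.

Definition homology_based_arrow : H1 R A -> T :=
  zquot_lift rel_based_arrow_null_cycle.
HB.instance Definition _ := GRing.Additive.on homology_based_arrow.

(** Both this composite and the identity extend the universal morphism, by
    [based_arrow_vertex]; uniqueness in the universal property concludes. *)
Lemma homology_based_arrow_natural : cancel (natural_morphism R A) homology_based_arrow.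
Proof.
have [phi [_ phiU]] := totab_universal (totab_unit (pi1 R A)).
move=> x; have idU := phiU idfun (fun _ _ _ => erefl) x.
rewrite -[RHS]/(idfun x) idU.
apply: (phiU (homology_based_arrow \o natural_morphism R A)) => a b f /=.
rewrite -(pclass_repr f) natural_morphismE.
rewrite /homology_based_arrow zquot_liftE /= rel_based_arrow_line.
exact: based_arrow_vertex.
Qed.

(** * Projection of relative chains onto cycles *)

Definition free_base_paths : {freeg (scube R X 0) / int} -> rel_chains R A 1 :=
  free_lift (fun k : scube R X 0 => rel_chain A (line_chain (g (k (fun=> zero))))).
HB.instance Definition _ := GRing.Additive.on free_base_paths.

Lemma free_base_paths_degenerate c : @degenerate_chains R X 0 c -> free_base_paths c = 0.
Proof. by move=> []. Qed.

Definition chain_base_paths : chains R X 0 -> rel_chains R A 1 :=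
  zquot_lift free_base_paths_degenerate.
HB.instance Definition _ := GRing.Additive.on chain_base_paths.

Lemma chain_base_paths_point x : chain_base_paths (point R x) = rel_chain A (line_chain (g x)).
Proof. by rewrite /chain_base_paths zquot_liftE /= /free_base_paths free_liftU. Qed.

Lemma cube_chain_point (k : scube R X 0) : cube_chain k = point R (k (fun=> zero)).
Proof.
congr cube_chain; apply/continuousEP => t; rewrite /= /mkcts.
by congr (k _); exact: icube0_eq.
Qed.

Lemma chain_base_paths_subspace c : @subspace_chains R X A 0 c -> chain_base_paths c = 0.
Proof.
move=> [k Ak <-]; rewrite cube_chain_point chain_base_paths_point.
have gk : forall t, g (k (fun=> zero)) t = k (fun=> zero) by apply: gA; exact: Ak.
by rewrite /rel_chain (line_chain_cst gk) raddf0.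
Qed.

Definition rel_base_paths : rel_chains R A 0 -> rel_chains R A 1 :=
  zquot_lift chain_base_paths_subspace.
HB.instance Definition _ := GRing.Additive.on rel_base_paths.

Lemma rel_base_paths_point x :
  rel_base_paths (rel_chain A (point R x)) = rel_chain A (line_chain (g x)).
Proof. by rewrite /rel_base_paths zquot_liftE; exact: chain_base_paths_point. Qed.

(** The far end of each chosen path lies in A, hence vanishes in relative chains;
    only the starting point remains, with a minus sign. *)
Lemma rel_boundary_base_paths c : rel_boundary (rel_base_paths c) = - c.
Proof.
apply: (rel_chains_ext (f := @rel_boundary R X A 0 \o rel_base_paths) (g := -%R)) => k /=.
rewrite cube_chain_point rel_base_paths_point rel_boundaryE boundary_line /rel_chain raddfB /=.
set x := k _; suff -> : zproj (@subspace_chains R X A 0) (point R (set_val (e x))) = 0.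
  by rewrite sub0r.
by apply: zproj_gen; eexists; [|reflexivity] => t; exact: set_valP.
Qed.

Lemma rel_boundary_cycle_projection c : rel_boundary (c + rel_base_paths (rel_boundary c)) = 0.
Proof. by rewrite raddfD /= rel_boundary_base_paths subrr. Qed.

Definition cycle_projection (c : rel_chains R A 1) : zker (@rel_boundary R X A 0) :=
  to_zker (rel_boundary_cycle_projection c).

Lemma cycle_projection_is_zmod_morphism : zmod_morphism cycle_projection.
Proof. by move=> c d; apply: val_inj; rewrite /= !raddfB /= opprD addrACA. Qed.
HB.instance Definition _ := GRing.isZmodMorphism.Build _ _ cycle_projection
  cycle_projection_is_zmod_morphism.

Lemma cycle_projection_id (z : zker (@rel_boundary R X A 0)) :
  cycle_projection (val z) = z.
Proof.
apply: val_inj => /=; have /eqP -> : rel_boundary (val z) == 0 := valP z.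
by rewrite raddf0 addr0.
Qed.

(** * Homology classes of conjugated paths *)

Definition boundaries : set (chains R X 1) :=
  [set c | exists d : chains R X 2, boundary d = c].

Lemma boundaries_subgroup : subgroup boundaries.
Proof.
split=> [|c c' [d dc] [d' dc']]; first by exists 0; rewrite raddf0.
by exists (d - d'); rewrite raddfB /= dc dc'.
Qed.

(** Working in the quotient of absolute 1-chains by boundaries turns the bounding
    chains of concatenations and homotopies into equations one can rewrite with. *)
Local Notation bproj := (zproj boundaries).

Lemma bprojP c c' : bproj c = bproj c' <-> boundaries (c - c').
Proof. by rewrite zprojP generated_id//; exact: boundaries_subgroup. Qed.

Lemma bproj_homology (z z' : zker (@rel_boundary R X A 0)) c c' :
  val z = rel_chain A c -> val z' = rel_chain A c' -> bproj c = bproj c' ->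
  zproj _ z = zproj _ z' :> H1 R A.
Proof.
move=> zc zc' /bprojP[d dc]; apply/zprojP; apply: sub_generated.
exists (rel_chain A d); rewrite [RHS]raddfB /= rel_boundaryE dc zc zc'.
exact: raddfB.
Qed.

Lemma bproj_comp x y (z : X) (f : ipath R x y) (f' : ipath R y z) :
  bproj (line_chain (path_comp f f')) = bproj (line_chain f) + bproj (line_chain f').
Proof. by rewrite -raddfD; apply/bprojP; exact: line_chain_comp. Qed.

Lemma bproj_inv x y (f : ipath R x y) :
  bproj (line_chain (path_inv f)) = - bproj (line_chain f).
Proof.
apply/eqP; rewrite -addr_eq0 -bproj_comp; apply/eqP.
rewrite -[RHS](raddf0 bproj) -(line_chain_cst (u := path_id R y) (fun=> erefl)).
by apply/bprojP; apply: line_chain_homotopic; exact: path_compVf.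
Qed.

(** On a generator f from x to y, the left side is the class of the path
    (g x)^-1 . f . g y and the right side that of f + g y - g x. *)
Lemma natural_based_arrow c :
  natural_morphism R A (rel_based_arrow c) = zproj _ (cycle_projection c).
Proof.
apply: (rel_chains_ext (f := natural_morphism R A \o rel_based_arrow)
  (g := zproj _ \o cycle_projection)) => k /=.
rewrite cube_chain_path; set f := path_of _.
rewrite rel_based_arrow_line natural_morphismE.
set x := unline k zero; set y := unline k one.
apply: (@bproj_homology _ _ _ (line_chain f + (line_chain (g y) - line_chain (g x)))) => //.
  rewrite /= rel_boundaryE boundary_line /rel_chain !raddfB /= !rel_base_paths_point.
  by rewrite raddfD raddfB.
by rewrite !bproj_comp bproj_inv raddfD raddfB /= addrC addrA.
Qed.

Lemma natural_homology_based_arrow : cancel homology_based_arrow (natural_morphism R A).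
Proof.
move=> x; have [z <-] := zproj_surj x.
by rewrite /homology_based_arrow zquot_liftE /= natural_based_arrow cycle_projection_id.
Qed.

End inverse.

(** * Choice of paths to the base points *)

Section base_paths.
Local Open Scope classical_set_scope.

(** A point of A is joined to itself by the constant path; this is what makes the
    inverse restrict to the identity on arrows between points of A. *)
Lemma base_path {R : realType} {X : topologicalType} {A : set X} :
  meets_path_components R A ->
  forall x, {a : A & {p : ipath R x (set_val a) | A x -> forall t, p t = x}}.
Proof.
move=> Apc x; have [Ax|nAx] := pselect (A x).
  by exists (SigSub (mem_set Ax)), (path_id R x).
have /cid[y [Ay xy]] := Apc x.
have /cid[p _] : exists p : ipath R x y, True by case: xy => p; exists p.
by exists (SigSub (mem_set Ay)), p.
Qed.

End base_paths.

Theorem theorem5p8 (R : realType) (X : topologicalType) (A : set X)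
  (Atpd : totally_path_disconnected R A) (Apc : meets_path_components R A) :
  bijective (natural_morphism R A).
Proof.
have gA x := proj2_sig (projT2 (base_path Apc x)).
exists (homology_based_arrow Atpd (fun x => proj1_sig (projT2 (base_path Apc x)))).
- exact: homology_based_arrow_natural gA.
- exact: natural_homology_based_arrow gA.
Qed.
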